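(* Let $p$ be a prime and $n\ge 1$ an integer. The perfect kernel of the space ${\rm Sub}(\mathcal{L}_{n,p})$ is ${\rm Sub}(\mathcal{A}_{n,p})$. Moreover, the Cantor–Bendixson rank of ${\rm Sub}(\mathcal{L}_{n,p})$ is the first infinite ordinal $\omega$.
   Context: $\mathcal{L}_{n,p}=(\mathbb{Z}/p\mathbb{Z})^n\wr\mathbb{Z}=\left(\bigoplus_{\mathbb{Z}}(\mathbb{Z}/p\mathbb{Z})^n\right)\rtimes\mathbb{Z}$ (the lamplighter group, $\mathbb{Z}$ acting by shifting coordinates), and $\mathcal{A}_{n,p}=\bigoplus_{\mathbb{Z}}(\mathbb{Z}/p\mathbb{Z})^n\le\mathcal{L}_{n,p}$. For a countable group $G$, ${\rm Sub}(G)$ is the set of all subgroups of $G$, identified with a subset of $\{0,1\}^G$ via characteristic functions and given the induced product topology (so $H_i\to H$ iff for every $g\in G$ the truth value of $g\in H_i$ is eventually equal to that of $g\in H$); it is compact metrizable. The perfect kernel of a Polish space is its unique perfect subset with countable complement (the eventual value of the iterated Cantor–Bendixson derivatives, where $X'$ is the set of non-isolated points of $X$, $X^{\alpha+1}=(X^\alpha)'$, $X^\lambda=\bigcap_{\alpha<\lambda}X^\alpha$ for limit $\lambda$); the Cantor–Bendixson rank is the least ordinal $\alpha$ with $X^{\alpha}=X^{\alpha+1}$. *)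

(* Defs.v *)
From Stdlib Require List.
From mathcomp Require Import all_boot all_algebra.
Set Implicit Arguments. Unset Strict Implicit. Unset Printing Implicit Defensive.
Import GRing.Theory.
Local Open Scope ring_scope.

(** * The lamplighter group L_{n,p} = (Z/pZ)^n wr Z
    Elements are pairs (f, a) with f : Z -> (Z/pZ)^n finitely supported
    and a : Z.  The ambient type [lamp n p] also contains non-finitely
    supported f; the group is the subset [is_lamp]. *)
Definition lamp (n p : nat) := ((int -> 'I_n -> 'Z_p) * int)%type.

Definition is_lamp (n p : nat) (x : lamp n p) : Prop :=
  exists N : nat, forall (m : int) (i : 'I_n), (N < `|m|)%N -> x.1 m i = 0.

Definition lamp_one (n p : nat) : lamp n p := (fun _ _ => 0, 0).

(* (f,a)(g,b) = (f + a.g, a+b), where (a.g)(m) = g(m - a) (shift action) *)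
Definition lamp_mul (n p : nat) (x y : lamp n p) : lamp n p :=
  (fun m i => x.1 m i + y.1 (m - x.2) i, x.2 + y.2).

Definition lamp_inv (n p : nat) (x : lamp n p) : lamp n p :=
  (fun m i => - x.1 (m + x.2) i, - x.2).

Definition is_subgroup (n p : nat) (H : lamp n p -> Prop) : Prop :=
  [/\ forall x, H x -> is_lamp x,
      H (lamp_one n p),
      forall x y, H x -> H y -> H (lamp_mul x y)
    & forall x, H x -> H (lamp_inv x)].

Definition SubL (n p : nat) : (lamp n p -> Prop) -> Prop :=
  fun H => is_subgroup H.

Definition SubA (n p : nat) : (lamp n p -> Prop) -> Prop :=
  fun H => is_subgroup H /\ forall x, H x -> x.2 = 0.

(** * Topology of {0,1}^T restricted to a family of subsets.
    Basic open sets (cylinders) are given by finitely many coordinates. *)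
Section Topo.
Variable T : Type.

Definition agree_on (F : list T) (H K : T -> Prop) : Prop :=
  forall g, List.In g F -> (H g <-> K g).

Definition isolated_in (Y : (T -> Prop) -> Prop) (H : T -> Prop) : Prop :=
  exists F : list T, forall K, Y K -> agree_on F H K -> K = H.

Definition deriv (Y : (T -> Prop) -> Prop) : (T -> Prop) -> Prop :=
  fun H => Y H /\ ~ isolated_in Y H.

Fixpoint CB_iter (X : (T -> Prop) -> Prop) (k : nat) : (T -> Prop) -> Prop :=
  match k with
  | O => X
  | S k => deriv (CB_iter X k)
  end.

Definition CB_omega (X : (T -> Prop) -> Prop) : (T -> Prop) -> Prop :=
  fun H => forall k, CB_iter X k H.

Definition CB_rank_is_omega (X : (T -> Prop) -> Prop) : Prop :=
  (forall k : nat, CB_iter X k.+1 <> CB_iter X k) /\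
  deriv (CB_omega X) = CB_omega X.

Definition closed_in (X Y : (T -> Prop) -> Prop) : Prop :=
  forall H, X H -> (forall F : list T, exists K, Y K /\ agree_on F H K) -> Y H.

Definition perfect_in (X Y : (T -> Prop) -> Prop) : Prop :=
  [/\ forall H, Y H -> X H, closed_in X Y & forall H, Y H -> ~ isolated_in Y H].

Definition countable_fam (A : (T -> Prop) -> Prop) : Prop :=
  exists f : nat -> (T -> Prop), forall H, A H -> exists i, f i = H.

Definition is_perfect_kernel (X Y : (T -> Prop) -> Prop) : Prop :=
  perfect_in X Y /\ countable_fam (fun H => X H /\ ~ Y H).
End Topo.

(* Main.v *)
(** A subgroup H outside Sub(A) contains some x = (a, d) with d > 0.  Record, for
    each position v, the set Lead H v of top coefficients at v of elements of
    H ∩ A; it is d-periodic in v and its elements are realised by elements of H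
    of bounded width.  Conjugation by x pushes supports to the right, and
    commuting y ∈ H with x^-1 shows that the top coefficient of y lies in Lead H,
    so every y reduces to a fixed finite window.  Hence H is finitely generated
    (so Sub(L) \ Sub(A) is countable), the neighbours K of H contain H, and a
    neighbour with the same leads is H itself.  As the leads of K ⊇ H can grow
    only finitely often, H disappears at a finite stage of the Cantor-Bendixson
    process.  No point of Sub(A) is isolated: restrict H to large balls or,
    if that changes nothing, add everything supported outside of a ball.
    Conversely, replacing one by one the zero blocks of the module by the ideals
    (t^(dQ) - 1) with Q large gives subgroups outside Sub(A) of arbitrarily large
    finite rank. *)
Require Import Defs.
From mathcomp Require Import all_boot all_order all_algebra zify ring boolp.
Set Implicit Arguments. Unset Strict Implicit. Unset Printing Implicit Defensive.
Import Order.TTheory GRing.Theory Num.Theory.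
Local Open Scope ring_scope.

(** * Group laws and closure rules for subgroups *)

Lemma lamp_ext n p (x y : lamp n p) :
  (forall m i, x.1 m i = y.1 m i) -> x.2 = y.2 -> x = y.
Proof.
case: x y => [f a] [g b] /= fg ->; congr pair.
by apply/funext => m; apply/funext => i.
Qed.

Lemma lamp_mulA n p : associative (@lamp_mul n p).
Proof.
move=> x y z; apply: lamp_ext => /= [m i|]; last by rewrite addrA.
by rewrite addrA opprD addrA.
Qed.

Lemma lamp_mul1l n p : left_id (@lamp_one n p) (@lamp_mul n p).
Proof. by move=> x; apply: lamp_ext => /= [m i|]; rewrite add0r ?subr0. Qed.

Lemma lamp_mul1r n p : right_id (@lamp_one n p) (@lamp_mul n p).
Proof. by move=> x; apply: lamp_ext => /= [m i|]; rewrite addr0. Qed.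

Lemma lamp_mulVl n p : left_inverse (@lamp_one n p) (@lamp_inv n p) (@lamp_mul n p).
Proof.
move=> x; apply: lamp_ext => /= [m i|]; last by rewrite addNr.
by rewrite opprK addNr.
Qed.

Lemma lamp_mulVr n p : right_inverse (@lamp_one n p) (@lamp_inv n p) (@lamp_mul n p).
Proof.
move=> x; apply: lamp_ext => /= [m i|]; last by rewrite addrN.
by rewrite subrK addrN.
Qed.

Lemma lamp_mulK n p (x y : lamp n p) : lamp_mul (lamp_mul x y) (lamp_inv y) = x.
Proof. by rewrite -lamp_mulA lamp_mulVr lamp_mul1r. Qed.

Lemma lamp_mulKl n p (x y : lamp n p) : lamp_mul (lamp_inv x) (lamp_mul x y) = y.
Proof. by rewrite lamp_mulA lamp_mulVl lamp_mul1l. Qed.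

Section Subgroup.
Variables (n p : nat) (H : lamp n p -> Prop).
Hypothesis sgH : is_subgroup H.

Lemma sg_lamp x : H x -> is_lamp x. Proof. by case: sgH => + _ _ _; apply. Qed.
Lemma sg_one : H (@lamp_one n p). Proof. by case: sgH. Qed.
Lemma sg_mul x y : H x -> H y -> H (lamp_mul x y).
Proof. by case: sgH => _ _ + _; apply. Qed.
Lemma sg_inv x : H x -> H (lamp_inv x). Proof. by case: sgH => _ _ _; apply. Qed.

Lemma sg_mulr x y : H y -> H (lamp_mul x y) -> H x.
Proof. by move=> Hy Hxy; rewrite -(lamp_mulK x y); apply: sg_mul => //; apply: sg_inv. Qed.

Lemma sg_mull x y : H x -> H (lamp_mul x y) -> H y.
Proof. by move=> Hx Hxy; rewrite -(lamp_mulKl x y); apply: sg_mul => //; apply: sg_inv. Qed.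

End Subgroup.

(** * Finite lists and windows of group elements *)

Lemma In_image (I : finType) U (f : I -> U) x : List.In (f x) [seq f y | y : I].
Proof.
rewrite /image_mem; have : x \in enum I by rewrite mem_enum.
elim: (enum I) => //= y s IHs; rewrite inE => /orP[/eqP ->|/IHs]; by [left|right].
Qed.

Lemma In_cat U (s t : list U) x : List.In x (s ++ t) <-> List.In x s \/ List.In x t.
Proof. by elim: s => [|y s IHs] /=; [tauto|rewrite IHs; tauto]. Qed.

Lemma In_filterP U (s : list U) (P : U -> Prop) :
  exists t : list U, forall x, List.In x t <-> List.In x s /\ P x.
Proof.
exists [seq x <- s | `[< P x >]] => x; elim: s => [|y s IHs] /=; first by tauto.
case: asboolP => Py /=; rewrite IHs; last by intuition congruence.
by split=> [[<-|]|]; tauto.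
Qed.

Lemma nth_image_seq (U : Type) (u0 : U) (W F : list U) :
  (forall u, List.In u F -> List.In u W) -> exists s, [seq nth u0 W k | k <- s] = F.
Proof.
elim: F => [|u F IHF] FW; first by exists [::].
have [|s <-] := IHF; first by move=> v vF; apply: FW; right.
have [k <-] : exists k, nth u0 W k = u.
  have := FW u (or_introl erefl).
  elim: W {IHF FW} => //= v W IHW [->|/IHW[k <-]]; first by exists 0%N.
  by exists k.+1.
by exists (k :: s).
Qed.

Section Window.
Variables (n p : nat).

Definition supp_in N (y : lamp n p) := forall (m : int) i, (N < `|m|)%N -> y.1 m i = 0.

(** An index [k] encodes the position or the shift [k - N]. *)
Definition window_elt N (u : {ffun 'I_(N + N).+1 -> {ffun 'I_n -> 'Z_p}} * 'I_(N + N).+1) :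
    lamp n p :=
  (fun m i => if (`|m| <= N)%N then u.1 (inord (absz (m + N%:Z))) i else 0,
   (u.2 : nat)%:Z - N%:Z).

Definition window N : list (lamp n p) := [seq @window_elt N u | u : _].

Lemma In_window N (y : lamp n p) : supp_in N y -> (`|y.2| <= N)%N -> List.In y (window N).
Proof.
move=> sy y2.
pose h := [ffun k : 'I_(N + N).+1 => [ffun i => y.1 ((k : nat)%:Z - N%:Z) i]].
suff -> : y = window_elt (h, inord (absz (y.2 + N%:Z))) by apply: In_image.
apply: lamp_ext => /= [m i|]; last by rewrite inordK; lia.
case: ifP => mN; last by apply: sy; lia.
by rewrite !ffunE inordK; [congr (y.1 _ _); lia | lia].
Qed.

(** Coordinates of a cylinder range over the ambient type, so [F] may contain elements outside the
    group; the bound skips them. *)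
Lemma supp_bound (F : list (lamp n p)) :
  exists N, forall y, List.In y F -> is_lamp y -> supp_in N y /\ (`|y.2| <= N)%N.
Proof.
elim: F => [|y F [N IHN]] /=; first by exists 0%N.
have [[M yM]|ny] := EM (is_lamp y); last first.
  by exists N => z [<-|]; [|apply: IHN].
exists (maxn (maxn M N) `|y.2|) => z [<- _|zF zl].
  by split=> [m i mN|]; [apply: yM; lia|lia].
by have [sz z2] := IHN z zF zl; split=> [m i mN|]; [apply: sz; lia|lia].
Qed.

End Window.

(** * Leading coefficients and reduction to a window *)

Section Reduction.
Variables (n p : nat).
Implicit Types (P Q H K : lamp n p -> Prop) (x y f g : lamp n p).

Definition Lead Q (v : int) (w : 'I_n -> 'Z_p) :=
  exists f, [/\ Q f, f.2 = 0, forall m i, v < m -> f.1 m i = 0 & f.1 v =1 w].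

Definition short_lift N P (v : int) (w : 'I_n -> 'Z_p) :=
  exists g, [/\ P g, g.2 = 0,
    forall m i, (m < v - N%:Z) || (v < m) -> g.1 m i = 0 & g.1 v =1 w].

Lemma conj_base x f : f.2 = 0 ->
  lamp_mul (lamp_mul x f) (lamp_inv x) = (fun m i => f.1 (m - x.2) i, 0).
Proof.
move=> f0; apply: lamp_ext => /= [m i|]; rewrite f0 addr0 ?subrr //.
by rewrite subrK addrC addrA addNr add0r.
Qed.

Lemma conjV_base x f : f.2 = 0 ->
  lamp_mul (lamp_mul (lamp_inv x) f) x = (fun m i => f.1 (m + x.2) i, 0).
Proof.
move=> f0; apply: lamp_ext => /= [m i|]; rewrite f0 addr0 ?addNr //.
by rewrite opprK addrC addrA addrN add0r.
Qed.

Lemma sg_conj H x f : is_subgroup H -> H x -> f.2 = 0 -> H f ->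
  H (fun m i => f.1 (m - x.2) i, 0).
Proof. by move=> sH Hx f0 Hf; rewrite -conj_base //; do ?apply: sg_mul => //; exact: sg_inv. Qed.

Lemma sg_conjV H x f : is_subgroup H -> H x -> f.2 = 0 -> H f ->
  H (fun m i => f.1 (m + x.2) i, 0).
Proof. by move=> sH Hx f0 Hf; rewrite -conjV_base //; do ?apply: sg_mul => //; exact: sg_inv. Qed.

Lemma Lead_shift H x v w : is_subgroup H -> H x -> Lead H (v + x.2) w <-> Lead H v w.
Proof.
move=> sH Hx; split=> -[f [Hf f0 fv fw]].
  eexists; split; [exact: (sg_conjV sH Hx f0 Hf)|by []| |] => /= [m i vm|i].
    by apply: fv; lia.
  exact: fw.
eexists; split; [exact: (sg_conj sH Hx f0 Hf)|by []| |] => /= [m i vm|i].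
  by apply: fv; lia.
by rewrite addrK.
Qed.

Lemma short_lift_shift N H x v w :
  is_subgroup H -> H x -> short_lift N H (v + x.2) w <-> short_lift N H v w.
Proof.
move=> sH Hx; split=> -[f [Hf f0 fv fw]].
  eexists; split; [exact: (sg_conjV sH Hx f0 Hf)|by []| |] => /= [m i vm|i].
    by apply: fv; lia.
  exact: fw.
eexists; split; [exact: (sg_conj sH Hx f0 Hf)|by []| |] => /= [m i vm|i].
  by apply: fv; lia.
by rewrite addrK.
Qed.

Lemma int_periodic (R : int -> Prop) (d : int) : 0 < d ->
  (forall v, R (v + d) <-> R v) -> (forall r : nat, r%:Z < d -> R r%:Z) -> forall v, R v.
Proof.
move=> d0 Rd R0 v.
have Rk (k : nat) u : R (u + k%:Z * d) <-> R u.
  elim: k u => [|k IHk] u; first by rewrite mul0r addr0.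
  by rewrite -[k.+1]addn1 PoszD mulrDl mul1r addrA Rd.
have Rv : R (v %% d)%Z.
  have -> : (v %% d)%Z = `|(v %% d)%Z|%N by lia.
  by apply: R0; lia.
rewrite (divz_eq v d) addrC; case: (v %/ d)%Z => k; first exact/Rk.
by rewrite -(Rk k.+1) NegzE mulNr addrNK.
Qed.

(** Multiplying by [x] and by lifts, all in both [P] and [Q], does not affect membership. The shift
    is normalised first, then the left end of the support, then the right end. [M] depends on [x]
    and [N] only, so [P] and [Q] may be exchanged. *)
Lemma sub_of_short_lift x N : is_lamp x -> 0 < x.2 -> exists M : nat, forall P Q,
  is_subgroup P -> is_subgroup Q -> P x -> Q x ->
  (forall v w, Lead Q v w -> short_lift N (fun g => P g /\ Q g) v w) ->
  (forall y, List.In y (window n p M) -> Q y -> P y) ->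
  forall y, Q y -> P y.
Proof.
(* [B] covers the support of [x] and its translates by at most [d]; the extra [N] makes a lift with
   top above [M] start right of [-B]. *)
move=> [A xA] d0; pose d := x.2; pose B := (A + `|d|)%N; pose M := (B + N)%N.
exists M => P Q sP sQ Px Qx lift win.
have top (k : nat) y : 0 <= y.2 < d -> Q y ->
    (forall (m : int) i, m < - B%:Z -> y.1 m i = 0) ->
    (forall (m : int) i, M%:Z + k%:Z < m -> y.1 m i = 0) -> P y.
  elim: k y => [|k IHk] y yd Qy ylo yhi.
    apply: win => //; apply: In_window => [m i mM|]; last by lia.
    by have [?|?] := ltP m 0; [apply: ylo|apply: yhi]; lia.
  pose v := M%:Z + k.+1%:Z.
  have /lift[g [[Pg Qg] g0 gv gw]] : Lead Q v (y.1 v).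
    (* the top coefficient of [y] survives in the commutator of [y] with [x^-1] *)
    exists (lamp_mul (lamp_mul (lamp_mul y (lamp_inv x)) (lamp_inv y)) x); split.
    - by do ?apply: sg_mul => //; exact: sg_inv.
    - by rewrite /=; lia.
    - move=> m i vm /=; rewrite yhi ?xA ?yhi ?xA; [ring|lia..].
    - by move=> i /=; rewrite !xA; [rewrite [y.1 (_ + _) i]yhi; [ring|lia]|lia..].
  apply: (sg_mull sP (sg_inv sP Pg)); apply: IHk.
  - by rewrite /= g0; lia.
  - by apply: sg_mul => //; apply: sg_inv.
  - by move=> m i mB /=; rewrite g0 gv ?ylo; [ring|lia..].
  - move=> m i mB /=; rewrite g0 oppr0 !addr0.
    have [->|mv] := eqVneq m v; first by rewrite gw addNr.
    by rewrite gv ?yhi; [ring|lia..].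
have low (k : nat) y : 0 <= y.2 < d -> Q y ->
    (forall (m : int) i, m < - B%:Z - k%:Z -> y.1 m i = 0) -> P y.
  elim: k y => [|k IHk] y yd Qy ylo.
    have [C yC] := sg_lamp sQ Qy.
    by apply: (top C) => // m i mM; [apply: ylo|apply: yC]; lia.
  apply: (sg_mull sP Px); apply: (sg_mulr sP (sg_inv sP Px)); apply: IHk.
  - by rewrite /=; lia.
  - by do ?apply: sg_mul => //; exact: sg_inv.
  - by move=> m i mB /=; rewrite !xA ?ylo; [ring|lia..].
have high (k : nat) y : - k%:Z <= y.2 < d + k%:Z -> Q y -> P y.
  elim: k y => [|k IHk] y yd Qy.
    have [C yC] := sg_lamp sQ Qy.
    by apply: (low C) => // [|m i mM]; [lia|apply: yC; lia].
  have [y0|y0] := ltP y.2 0.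
    by apply: (sg_mulr sP Px); apply: IHk; [rewrite /=; lia|exact: sg_mul].
  have [yd'|yd'] := ltP y.2 d; first by apply: IHk => //; lia.
  apply: (sg_mulr sP (sg_inv sP Px)); apply: IHk; first by rewrite /=; lia.
  by apply: sg_mul => //; exact: sg_inv.
by move=> y; apply: (high `|y.2|%N); lia.
Qed.

End Reduction.

(** * Finite generation and countability outside [SubA] *)

Section Structure.
Variables (n p : nat).
Implicit Types (P Q H K : lamp n p -> Prop) (x y f g : lamp n p).

Lemma is_subgroupI H K :
  is_subgroup H -> is_subgroup K -> is_subgroup (fun y => H y /\ K y).
Proof.
move=> sH sK; split=> [y [/(sg_lamp sH)]|||] //; first by split; apply: sg_one.
  by move=> y z [? ?] [? ?]; split; apply: sg_mul.
by move=> y [? ?]; split; apply: sg_inv.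
Qed.

(** One period has finitely many positions and vectors, so finitely many chosen witnesses cover all
    leads. *)
Lemma finite_leads H (d : int) : is_subgroup H ->
  exists N F, (forall g, List.In g F -> H g) /\
    forall (r : nat) w, r%:Z < d -> Lead H r%:Z w ->
      short_lift N (fun g => List.In g F) r%:Z w.
Proof.
move=> sH.
pose U : finType := ('I_`|d|%N * {ffun 'I_n -> 'Z_p})%type.
have /choice[G GP] (u : U) : exists g, Lead H (u.1 : nat)%:Z u.2 ->
    [/\ H g, g.2 = 0, forall (m : int) i, (u.1 : nat)%:Z < m -> g.1 m i = 0
      & g.1 (u.1 : nat)%:Z =1 u.2].
  have [[g gP]|nl] := EM (Lead H (u.1 : nat)%:Z u.2); first by exists g.
  by exists (@lamp_one n p).
(* [G u] is arbitrary when [u] is not a lead; the filter keeps only values in [H]. *)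
have [F FP] := In_filterP [seq G u | u : U] H.
have [N FN] := supp_bound F.
exists (N + `|d|)%N, F; split=> [g /FP[]//|r w rd [f [Hf f0 fr fw]]].
have rd' : (r < `|d|)%N by lia.
pose u : U := (Ordinal rd', [ffun i => w i]).
have [|Hg g0 gr gw] := GP u.
  by exists f; split=> // i; rewrite ffunE.
have gF : List.In (G u) F by apply/FP; split=> //; apply: In_image.
exists (G u); split=> // [m i /orP[mr|]|i]; [|exact: gr|by rewrite gw ffunE].
by have [+ _] := FN _ gF (sg_lamp sH Hg); apply; lia.
Qed.

(** [sub_of_short_lift] is used in both directions: [x], the lifts and the window part of [H] force
    [H] into [K], and the reverse inclusion can fail only through a new window element or a new lead
    of [K]. *)
Lemma subgroup_determined H x : is_subgroup H -> H x -> 0 < x.2 ->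
  exists F W, (forall y, List.In y F -> H y) /\
    forall K, is_subgroup K -> (forall y, List.In y F -> K y) ->
      (forall y, H y -> K y) /\
      ((forall y, List.In y W -> K y -> H y) ->
       (forall (r : nat) w, r%:Z < x.2 -> Lead K r%:Z w -> Lead H r%:Z w) ->
       forall y, K y -> H y).
Proof.
move=> sH Hx d0.
have [N [F [FH FN]]] := finite_leads x.2 sH.
have [M red] := sub_of_short_lift N (sg_lamp sH Hx) d0.
have [W WP] := In_filterP (window n p M) H.
exists (x :: F ++ W), (window n p M); split.
  by move=> y [<-//|/In_cat[/FH//|/WP[]//]].
move=> K sK FK.
have Kx : K x by apply: FK; left.
have lift v w : Lead H v w -> short_lift N (fun g => H g /\ K g) v w.
  move: v w; apply: (int_periodic d0) => [v|r rd w /(FN r w rd)].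
    have sI := is_subgroupI sH sK.
    by split=> IH w; have := IH w; rewrite (Lead_shift _ _ sH Hx) (@short_lift_shift _ _ N _ x).
  move=> [g [gF g0 gr gw]]; exists g; split=> //; split; first exact: FH.
  by apply: FK; right; apply/In_cat; left.
split.
  apply: (red K H) => // [v w /lift[g [[? ?] ? ? ?]]|y yW Hy]; first by exists g.
  by apply: FK; right; apply/In_cat; right; apply/WP.
move=> KH leads; apply: (red H K) => // v w; move=> KL; apply: lift; move: v w KL.
apply: (int_periodic d0) => [v|r rd w]; last exact: leads.
by split=> IH w; have := IH w; rewrite !(Lead_shift _ _ _ Hx) ?(@Lead_shift _ _ K x).
Qed.

Definition generated (F : list (lamp n p)) : lamp n p -> Prop :=
  fun y => forall K, is_subgroup K -> (forall z, List.In z F -> K z) -> K y.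

Lemma pos_elt H : is_subgroup H -> ~ SubA H -> exists2 x, H x & 0 < x.2.
Proof.
move=> sH nA; apply: contrapT => nx; apply: nA; split=> // x Hx.
apply/eqP; apply: contraT => x0; case: nx.
have [xneg|xpos] := ltP x.2 0.
  by exists (lamp_inv x); [apply: sg_inv|rewrite /= oppr_gt0].
by exists x => //; rewrite lt0r x0.
Qed.

Lemma countable_outside_SubA : countable_fam (fun H => SubL H /\ ~ @SubA n p H).
Proof.
(* A code is a window size with indices of generators in that window; undecodable numbers get the
   default. *)
exists (fun k => let u : nat * seq nat := odflt (0%N, [::]) (unpickle k) in
  generated [seq nth (@lamp_one n p) (window n p u.1) j | j <- u.2]).
move=> H [sH /(pos_elt sH)[x Hx d0]].
have [F [W [FH FK]]] := subgroup_determined sH Hx d0.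
have [N FN] := supp_bound F.
have [y yF|s sF] := nth_image_seq (@lamp_one n p) (W := window n p N) (F := F).
  by have [? ?] := FN y yF (sg_lamp sH (FH y yF)); apply: In_window.
exists (pickle (N, s)); rewrite pickleK /= sF.
apply/funext => y; apply/propext; split=> [|Hy K sK FsubK]; first exact.
by have [HK _] := FK K sK FsubK; apply: HK.
Qed.

End Structure.

(** * Iterated derivatives *)

Section CantorBendixson.
Variable T : Type.
Implicit Types (X : (T -> Prop) -> Prop) (H : T -> Prop).

Lemma CB_iter_sub X k l H : (k <= l)%N -> CB_iter X l H -> CB_iter X k H.
Proof.
move=> /subnK <-; elim: (l - k)%N => //= j IHj [] XH _; exact: IHj.
Qed.

Lemma isolated_in_sub X Y H : (forall K, Y K -> X K) -> isolated_in X H -> isolated_in Y H.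
Proof. by move=> YX [F FP]; exists F => K YK; apply: FP; apply: YX. Qed.

Lemma perfect_sub_CB_iter X Y k H :
  (forall K, Y K -> X K) -> (forall K, Y K -> ~ isolated_in Y K) -> Y H -> CB_iter X k H.
Proof.
move=> YX Yp; elim: k H => [|k IHk] H YH /=; first exact: YX.
by split; [exact: IHk|move/(isolated_in_sub IHk); apply: Yp].
Qed.

End CantorBendixson.

(** * Disappearance at a finite stage outside [SubA] *)

Section UpperBound.
Variables (n p : nat).
Implicit Types (H K : lamp n p -> Prop) (x : lamp n p).

Definition lead_set x H : {set 'I_`|x.2|%N * {ffun 'I_n -> 'Z_p}} :=
  [set u : 'I_`|x.2|%N * {ffun 'I_n -> 'Z_p} | `[< Lead H (u.1 : nat)%:Z u.2 >]].

Lemma lead_setS x H K : (forall y, H y -> K y) -> lead_set x H \subset lead_set x K.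
Proof.
move=> HK; apply/fintype.subsetP => u; rewrite !inE => /asboolP[f [Hf ? ? ?]].
by apply/asboolP; exists f; split=> //; apply: HK.
Qed.

(** Induction on the number of missing leads: a close neighbour [K] other than [H] has strictly more
    leads, so it is gone one stage earlier and [H] is isolated among the survivors. *)
Lemma rank_bound x c H : is_subgroup H -> H x -> 0 < x.2 ->
  (#|~: lead_set x H| < c)%N -> ~ CB_iter (@SubL n p) c H.
Proof.
move=> + + d0; elim: c H => // c IHc H sH Hx lt_c /= [_]; apply.
have [F [W [FH FK]]] := subgroup_determined sH Hx d0.
exists (F ++ W) => K CK agr.
have sK : is_subgroup K by apply: (CB_iter_sub (leq0n c)) CK.
have [|HK KH] := FK K sK.
  by move=> y yF; apply: (proj1 (agr y _)); [apply/In_cat; left|exact: FH].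
suff KsubH : forall y, K y -> H y.
  by apply/funext => y; apply/propext; split; [exact: KsubH|exact: HK].
apply: KH => [y yW|r w rd KL]; first by apply: (proj2 (agr y _)) => //; apply/In_cat; right.
apply: contrapT => nHL; apply: IHc CK => //; first exact: HK.
rewrite -ltnS; apply: leq_trans lt_c; rewrite ltnS; apply: proper_card.
have rd' : (r < `|x.2|)%N by lia.
pose u : 'I_`|x.2|%N * {ffun 'I_n -> 'Z_p} := (Ordinal rd', [ffun i => w i]).
apply/fintype.properP; split; first by rewrite setCS lead_setS.
have LE Q : Lead Q r%:Z [ffun i => w i] <-> Lead Q r%:Z w.
  split=> -[f [? ? ? fw]]; exists f; split=> // i; rewrite fw ffunE //.
exists u; rewrite !inE.
  by apply/asboolP => /LE.
by rewrite negbK; apply/asboolP/LE.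
Qed.

End UpperBound.

(** * Perfectness of [SubA] *)

Section Perfect.
Variables (n p : nat).
Implicit Types (H K : lamp n p -> Prop) (x y : lamp n p).

Lemma SubA_closed : closed_in (@SubL n p) (@SubA n p).
Proof.
move=> H sH lim; split=> // x Hx.
by have [K [[_ KA] HK]] := lim [:: x]; apply/KA/HK => //; left.
Qed.

Definition delta (k : int) : lamp n p := (fun m _ => (m == k)%:R, 0).

Lemma is_lamp_delta k : is_lamp (delta k).
Proof. by exists `|k|%N => m i mk /=; rewrite (_ : (m == k) = false) //; apply/negbTE/eqP; lia. Qed.

Lemma is_lamp_mul x y : is_lamp x -> is_lamp y -> is_lamp (lamp_mul x y).
Proof.
move=> [A xA] [B yB]; exists (maxn A (B + `|x.2|)) => m i mAB /=.
by rewrite xA ?yB ?addr0 //; lia.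
Qed.

Lemma is_lamp_inv x : is_lamp x -> is_lamp (lamp_inv x).
Proof.
by move=> [A xA]; exists (A + `|x.2|)%N => m i mA /=; rewrite xA ?oppr0 //; lia.
Qed.

Lemma SubA_not_isolated H : (0 < n)%N -> SubA H -> ~ isolated_in (@SubA n p) H.
Proof.
move=> n0 [sH HA] [F isoF]; have [N FN] := supp_bound F.
(* Restricting [H] to the ball does not change its trace on [F], so isolation confines [H] to the
   ball. *)
have supH y : H y -> supp_in N y.
  pose K y := H y /\ supp_in N y.
  suff <- : K = H by case.
  apply: isoF => [|z zF]; last first.
    by split=> [Hz|[]//]; split=> //; have [] := FN z zF (sg_lamp sH Hz).
  split=> [|z [/HA]//]; move=> {y}; split=> [y [/(sg_lamp sH)]||y z [Hy yN] [Hz zN]|y [Hy yN]] //.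
  - by split=> //; apply: sg_one.
  - split=> [|m i mN /=]; first exact: sg_mul.
    by rewrite (HA y) // subr0 yN // zN // addr0.
  - split=> [|m i mN /=]; first exact: sg_inv.
    by rewrite (HA y) // addr0 yN // oppr0.
(* This [K] constrains only the part inside the ball: same trace on [F], yet it contains
   [delta N.+1]. *)
pose trunc y : lamp n p := (fun m i => if (`|m| <= N)%N then y.1 m i else 0, 0).
pose K y := [/\ is_lamp y, y.2 = 0 & H (trunc y)].
have KH : K = H.
  apply: isoF => [|y yF].
    split=> [|y []//]; split=> [y []||y z [yl y0 Hy] [zl z0 Hz]|y [yl y0 Hy]] //.
    - split=> //; first by exists 0%N.
      suff -> : trunc (@lamp_one n p) = @lamp_one n p by apply: sg_one.
      by apply: lamp_ext => //= m i; case: ifP.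
    - split; [exact: is_lamp_mul|by rewrite /= y0 z0 addr0|].
      suff -> : trunc (lamp_mul y z) = lamp_mul (trunc y) (trunc z) by apply: sg_mul.
      apply: lamp_ext => [m i|] /=; last by rewrite addr0.
      by rewrite y0 !subr0; case: ifP; rewrite ?addr0.
    - split; [exact: is_lamp_inv|by rewrite /= y0 oppr0|].
      suff -> : trunc (lamp_inv y) = lamp_inv (trunc y) by apply: sg_inv.
      apply: lamp_ext => [m i|] /=; last by rewrite oppr0.
      by rewrite y0 !addr0; case: ifP; rewrite ?oppr0.
  have truncE : is_lamp y -> y.2 = 0 -> trunc y = y.
    move=> yl y0; have [sy _] := FN y yF yl.
    apply: lamp_ext => [m i|] /=; last by rewrite y0.
    by case: ifP => // mN; rewrite sy //; lia.
  split=> [Hy|[yl y0]]; last by rewrite truncE.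
  by have yl := sg_lamp sH Hy; have y0 := HA y Hy; split; rewrite ?truncE.
have : K (delta N.+1).
  split=> //; first exact: is_lamp_delta.
  suff -> : trunc (delta N.+1) = @lamp_one n p by apply: sg_one.
  apply: lamp_ext => //= m i; case: ifP => // mN.
  by rewrite (_ : (m == _) = false) //; apply/negbTE/eqP; lia.
rewrite KH => /supH/(_ (N.+1 : int) (Ordinal n0)) /=.
by rewrite eqxx => /(_ (ltnSn _))/eqP; rewrite oner_eq0.
Qed.

End Perfect.

(** * Subgroups surviving many derivatives *)

Lemma modz_addMr (m k d : int) : ((m + k * d) %% d)%Z = (m %% d)%Z.
Proof. by rewrite addrC modzMDl. Qed.

Section LowerBound.
Variables (n p d : nat).
Hypothesis d_gt0 : (0 < d)%N.
Implicit Types (q : int -> nat) (y g : lamp n p).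

(* Identifying the base group with n-tuples over the group ring of the residues
   mod d, the base part is the ideal (t^(d * q r) - 1) in residue class r; it
   vanishes when [q r = 0] and converges to 0 when [q r] tends to infinity. *)
Definition comb q : lamp n p -> Prop := fun y =>
  [/\ is_lamp y, exists z : int, y.2 = z * d%:Z &
    exists2 g : lamp n p, is_lamp g & forall (m : int) i,
      y.1 m i = g.1 (m - d%:Z * (q (m %% d%:Z)%Z)%:Z) i - g.1 m i].

Lemma is_subgroup_comb q : is_subgroup (comb q).
Proof.
split=> [y []||x y [xl [a xa] [g gl gx]] [yl [b yb] [h hl hy]]|x [xl [a xa] [g gl gx]]] //.
- split; [by exists 0%N|by exists 0; rewrite mul0r|].
  by exists (@lamp_one n p) => [|m i]; [exists 0%N|rewrite /= subrr].
- split; [exact: is_lamp_mul|by exists (a + b); rewrite mulrDl -xa -yb|].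
  (* Carrying the shift of [x] makes the product translate [h] by [x.2], a multiple of [d], which
     preserves residues. *)
  exists (lamp_mul (g.1, x.2) h) => [|m i /=]; first exact: is_lamp_mul.
  rewrite gx hy xa.
  have -> : ((m - a * d%:Z) %% d%:Z = m %% d%:Z)%Z by rewrite -mulNr modz_addMr.
  rewrite [m - _ * _ - _]addrAC; ring.
- split; [exact: is_lamp_inv|by exists (- a); rewrite mulNr -xa|].
  exists (lamp_inv (g.1, x.2)) => [|m i /=]; first exact: is_lamp_inv.
  rewrite gx xa.
  have -> : ((m + a * d%:Z) %% d%:Z = m %% d%:Z)%Z by rewrite modz_addMr.
  rewrite [m + _ * _ - _]addrAC; ring.
Qed.

(** For [m] in the ball, no other point of the progression through [m] with step [D] is in it. So
    [g] is constant along it from [m] on and up to [m - D]; finite support makes both constants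
    zero, and [y] at [m] is their difference. *)
Lemma comb_far q r N y : (N + N < d * q r)%N -> comb q y -> supp_in N y ->
  forall (m : int) i, (m %% d%:Z)%Z = r -> y.1 m i = 0.
Proof.
move=> big [_ _ [g [C gC] gy]] yN m i mr.
have [|mN] := leqP `|m|%N N; last exact: yN.
move=> mN; pose D : int := (d * q r)%:Z.
have step (k : int) : y.1 (m + k * D) i = g.1 (m + (k - 1) * D) i - g.1 (m + k * D) i.
  rewrite gy; have -> : ((m + k * D) %% d%:Z)%Z = r.
    by rewrite /D PoszM [d%:Z * _]mulrC mulrA modz_addMr.
  by congr (g.1 _ _ - _); rewrite /D PoszM; ring.
have right (k : nat) : g.1 m i = g.1 (m + k%:Z * D) i.
  elim: k => [|k ->]; first by rewrite mul0r addr0.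
  apply/eqP; rewrite -subr_eq0; have := step k.+1%:Z.
  rewrite (_ : k.+1%:Z - 1 = k%:Z); last by lia.
  by move=> <-; rewrite yN //; nia.
have left (k : nat) : g.1 (m - D) i = g.1 (m - k.+1%:Z * D) i.
  elim: k => [|k ->]; first by rewrite mul1r.
  apply/esym/eqP; rewrite -subr_eq0; have := step (- k.+1%:Z).
  rewrite (_ : - k.+1%:Z - 1 = - k.+2%:Z) ?mulNr; last by lia.
  by move=> <-; rewrite yN //; nia.
have := step 0; rewrite mul0r addr0 sub0r mulN1r => ->.
(* [C + N + 1] steps of length at least 1 lead from the ball of radius [N] out of that of radius
   [C]. *)
rewrite (left (C + N)%N) (right (C + N).+1) !gC ?subr0 //; nia.
Qed.

(** Filling the zero block [j] with the ideal of a large [Q] gives a subgroup that survives [j]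
    stages by induction and approximates [comb q], which thus survives one more. *)
Lemma comb_CB_iter j q : (0 < n)%N -> (j <= d)%N ->
  (forall r : nat, (r < j)%N -> q r%:Z = 0%N) -> CB_iter (@SubL n p) j (comb q).
Proof.
move=> n0; elim: j q => [|j IHj] q jd q0 /=; first exact: is_subgroup_comb.
split; first by apply: IHj => [|r rj]; [lia|apply: q0; lia].
move=> [F isoF]; have [N FN] := supp_bound F.
have jmod : (j%:Z %% d%:Z)%Z = j%:Z by rewrite modz_small //; lia.
(* The period [d * Q] exceeds [2N], so by [comb_far] the new block contributes nothing to elements
   of [F]. *)
pose Q := (N + N).+1.
pose q' r := if r == j%:Z then Q else q r.
have modB (m : int) (k : nat) : ((m - d%:Z * k%:Z) %% d%:Z)%Z = (m %% d%:Z)%Z.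
  by rewrite [_ * k%:Z]mulrC -mulNr modz_addMr.
have E : comb q' = comb q.
  apply: isoF => [|y yF].
    apply: IHj => [|r rj]; first by lia.
    by rewrite /q' ifF; [apply: q0|]; lia.
  split=> [[yl yd [g gl gy]]|cy]; last first.
    have [yl yd [g gl gy]] := cy.
    have [sy _] := FN y yF yl.
    split=> //; exists g => // m i.
    have [mj|mj] := eqVneq (m %% d%:Z)%Z j%:Z; last by rewrite gy /q' (negbTE mj).
    rewrite mj q0 // mulr0 subr0 subrr; apply: comb_far cy sy m i mj.
    by rewrite /q' eqxx; nia.
  have [C gC] := gl; split=> //.
  (* An element of [comb q] vanishes on class [j], so its witness may be erased there and then
     serves for any [q' j]. *)
  exists ((fun m i => if (m %% d%:Z)%Z == j%:Z then 0 else g.1 m i), 0).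
    by exists C => m i mC /=; rewrite gC // if_same.
  move=> m i /=; rewrite modB /q'.
  have [mj|mj] := eqVneq (m %% d%:Z)%Z j%:Z; last by rewrite gy.
  by rewrite gy mj q0 // mulr0 subr0 !subrr.
(* An element of the new ideal: it lies in [comb q'] but not in [comb q], whose elements vanish at
   [j]. *)
pose y := lamp_mul (delta n p (j%:Z + d%:Z * Q%:Z)) (lamp_inv (delta n p j)).
have : comb q' y.
  split; [|by exists 0; rewrite mul0r|exists (delta n p j) => [|m i /=]].
  - by apply: is_lamp_mul; [|apply: is_lamp_inv]; apply: is_lamp_delta.
  - exact: is_lamp_delta.
  - rewrite !subr0 subr_eq; congr ((_ : bool)%:R - _); rewrite /q'.
    case: (eqVneq (m %% d%:Z)%Z j%:Z) => [//|mj].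
    by apply/eqP/eqP => E1; case/eqP: mj; rewrite {1}E1 [d%:Z * _]mulrC modz_addMr.
rewrite E => -[_ _ [g _ /(_ j%:Z (Ordinal n0))]].
rewrite jmod q0 // mulr0 subr0 subrr /= !subr0 eqxx.
rewrite (_ : (_ == _) = false); last by apply/negbTE/eqP; nia.
by rewrite sub0r => /eqP; rewrite oppr_eq0 oner_eq0.
Qed.

End LowerBound.

(** * Perfect kernel and rank *)

Theorem theorem1p1 (p n : nat) (hp : prime p) (hn : (1 <= n)%N) :
  is_perfect_kernel (@SubL n p) (@SubA n p) /\ CB_rank_is_omega (@SubL n p).
Proof.
have SubA_CB k H : SubA H -> CB_iter (@SubL n p) k H.
  by apply: perfect_sub_CB_iter => K; [case|apply: SubA_not_isolated].
have CB_SubA H : is_subgroup H -> ~ SubA H -> exists c, ~ CB_iter (@SubL n p) c H.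
  by move=> sH /(pos_elt sH)[x Hx d0]; eexists; apply: (rank_bound sH Hx d0); exact: ltnSn.
have omegaE : CB_omega (@SubL n p) = @SubA n p.
  apply/funext => H; apply/propext; split=> [HX|HA k]; last exact: SubA_CB.
  by apply: contrapT => /(CB_SubA H (HX 0%N))[c]; apply; apply: HX.
split; first split.
- split; [by move=> H []|exact: SubA_closed|by move=> H; apply: SubA_not_isolated].
- exact: countable_outside_SubA.
split=> [k stable|]; last first.
  rewrite omegaE; apply/funext => H; apply/propext; split=> [[]//|HA].
  by split=> //; apply: SubA_not_isolated.
(* With [q = 0] the comb is the cyclic group generated by [(0, k + 1)]: it survives [k] stages but
   lies outside [SubA], so it disappears later, whereas stability at [k] would keep it forever. *)
have Hk := @comb_CB_iter n p k.+1 isT k (fun=> 0%N) hn (leqnSn k) (fun _ _ => erefl).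
have sub := is_subgroup_comb n p k.+1 (fun=> 0%N).
have [[_ /(_ (fun _ _ => 0, k.+1%:Z))]|c] := CB_SubA _ sub.
  suff z : comb k.+1 (fun=> 0%N) ((fun _ _ => 0, k.+1%:Z) : lamp n p) by move/(_ z).
  split; [by exists 0%N|by exists 1; rewrite mul1r|].
  by exists (@lamp_one n p) => [|m i]; [exists 0%N|rewrite /= subrr].
have [ck|/ltnW/subnK <-] := leqP c k; first by apply; apply: CB_iter_sub ck Hk.
suff -> : CB_iter (@SubL n p) (c - k + k) = CB_iter (@SubL n p) k by apply.
by elim: (c - k)%N => //= j ->.
Qed.
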